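(* Let $\{V_n\}_{n\ge 0}$ be the Fennessey-Larcombe-French sequence, defined by $V_0=1$, $V_1=8$ and, for $n\ge 2$, $$(n-1)n^2 V_n = 8(n-1)(3n^2-n-1)V_{n-1} - 128(n-2)n^2 V_{n-2}.$$ Then the sequence $\{n!\,V_n\}_{n\ge 0}$ is strictly log-convex, that is, for all integers $n\ge 1$, $$n V_n^2 < (n+1)V_{n-1}V_{n+1}.$$
   Context: A real sequence $\{S_n\}$ is strictly log-convex if $S_n^2 < S_{n-1}S_{n+1}$ for all admissible $n$. *)

(* Defs.v *)
From mathcomp Require Import all_boot all_order all_algebra.
Set Implicit Arguments.
Unset Strict Implicit.
Unset Printing Implicit Defensive.
Import Order.TTheory GRing.Theory Num.Theory.
Local Open Scope ring_scope.

Definition strictly_log_convex (R : realFieldType) (S : nat -> R) : Prop :=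
  forall n : nat, (1 <= n)%N -> S n ^+ 2 < S n.-1 * S n.+1.

(* The leading coefficient (n - 1) n^2 is nonzero for n >= 2, so exactly one
   sequence satisfies this; existence is [fennessey_larcombe_french_ex]. *)
Definition fennessey_larcombe_french (R : realFieldType) (V : nat -> R) : Prop :=
  [/\ V 0%N = 1,
      V 1%N = 8 &
      forall n : nat, (2 <= n)%N ->
        (n%:R - 1) * n%:R ^+ 2 * V n =
          8 * (n%:R - 1) * (3 * n%:R ^+ 2 - n%:R - 1) * V n.-1
          - 128 * (n%:R - 2) * n%:R ^+ 2 * V n.-2].

Lemma fennessey_larcombe_french_ex (R : realFieldType) :
  exists V : nat -> R, fennessey_larcombe_french V.
Proof.
pose step (k : nat) (p : R * R) : R * R :=
  let x : R := k.+2%:R in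
  (p.2, (8 * (x - 1) * (3 * x ^+ 2 - x - 1) * p.2
         - 128 * (x - 2) * x ^+ 2 * p.1) / ((x - 1) * x ^+ 2)).
pose P n := iteri n step (1, 8).
exists (fun n => (P n).1); split=> // -[|[|k]] // _.
rewrite /= mulrC divfK // mulf_neq0 ?expf_neq0 ?pnatr_eq0 //.
by rewrite -[X in _ - X]/(1%:R) -natrB // subn1 pnatr_eq0.
Qed.

(* Main.v *)
(** The ratios [r n = V n / V n.-1] satisfy [16 <= r n < 16 (n + 1) / n] for
    [n >= 2]: the recurrence gives [r n] as an increasing function of
    [r n.-1], and both bounds are preserved by it.  Hence
    [(n + 1) r n.+1 >= 16 (n + 1) > n r n], which is the claim for [n >= 2]. *)

Require Import Defs.
From mathcomp Require Import all_boot all_order all_algebra.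
From mathcomp Require Import ring lra.
Import Order.TTheory GRing.Theory Num.Theory.
Local Open Scope ring_scope.

(** Multiplied by the leading coefficient, the gap [c - 16 * b] becomes a nonnegative multiple of
    the previous gap [b - 16 * a] plus [8 * b], since [(x - 1) * (x ^+ 2 - x - 1) = (x - 2) * x ^+ 2
    + 1]. *)
Lemma flf_ratio_lower_step (R : realFieldType) (x a b c : R) :
    2 <= x -> 0 < b -> 16 * a <= b ->
    (x - 1) * x ^+ 2 * c =
      8 * (x - 1) * (3 * x ^+ 2 - x - 1) * b - 128 * (x - 2) * x ^+ 2 * a ->
  16 * b <= c.
Proof.
move=> x2 b0 ab rec.
have k0 : 0 < (x - 1) * x ^+ 2 by rewrite mulr_gt0 ?exprn_gt0 //; lra.
have q0 : 0 <= (x - 2) * x ^+ 2 by rewrite mulr_ge0 ?exprn_ge0 //; lra.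
rewrite -(ler_pM2l k0) rec -subr_ge0.
set d := (X in 0 <= X).
have -> : d = 8 * ((x - 2) * x ^+ 2 * (b - 16 * a)) + 8 * b by rewrite /d; ring.
by rewrite addr_ge0 // mulr_ge0 ?(ltW b0) // mulr_ge0 // subr_ge0.
Qed.

(** The new gap, times [(x - 1) * x], is a nonnegative multiple of the old one plus a positive
    multiple of [b]; at [x = 2] only the latter survives, and it keeps the inequality strict. *)
Lemma flf_ratio_upper_step (R : realFieldType) (x a b c : R) :
    2 <= x -> 0 < b -> (x - 1) * b < 16 * x * a ->
    (x - 1) * x ^+ 2 * c =
      8 * (x - 1) * (3 * x ^+ 2 - x - 1) * b - 128 * (x - 2) * x ^+ 2 * a ->
  x * c < 16 * (x + 1) * b.
Proof.
move=> x2 b0 ab rec.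
have k0 : 0 < (x - 1) * x by rewrite mulr_gt0 //; lra.
have q0 : 0 <= (x - 2) * x by rewrite mulr_ge0 //; lra.
rewrite -(ltr_pM2l k0) -subr_gt0.
have -> : (x - 1) * x * (x * c) = (x - 1) * x ^+ 2 * c by ring.
rewrite rec; set d := (X in 0 < X).
have -> : d = 8 * ((x - 2) * x * (16 * x * a - (x - 1) * b))
              + 8 * ((x - 1) * (x + 1)) * b.
  by rewrite /d; ring.
rewrite ltr_wpDl //.
  by rewrite mulr_ge0 // mulr_ge0 // subr_ge0 ltW.
by rewrite mulr_gt0 // mulr_gt0 // mulr_gt0 //; lra.
Qed.

Lemma flf_ratio_bounds (R : realFieldType) (V : nat -> R) :
    fennessey_larcombe_french V ->
  forall n : nat, [/\ 0 < V n.+1, 16 * V n.+1 <= V n.+2 &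
                      n.+2%:R * V n.+2 < 16 * n.+3%:R * V n.+1].
Proof.
case=> V0 V1 rec; elim=> [|n [a0 lo up]].
  (* The recurrence gives [V 2 = 144]: here [128 <= 144] and [288 < 384]. *)
  by have := rec 2%N isT; rewrite /= V0 V1 => r; split; lra.
have b0 : 0 < V n.+2 by lra.
have x2 : 2 <= n.+3%:R :> R by rewrite ler_nat.
have r := rec n.+3 isT.
split=> //; first exact: flf_ratio_lower_step x2 b0 lo r.
rewrite -[n.+4%:R]natr1.
apply: flf_ratio_upper_step x2 b0 _ r.
by have -> : n.+3%:R - 1 = n.+2%:R :> R by rewrite -natr1 addrK.
Qed.

Lemma flf_log_convex_ineq (R : realFieldType) (V : nat -> R) :
    fennessey_larcombe_french V ->
  forall n : nat, n.+1%:R * V n.+1 ^+ 2 < n.+2%:R * V n * V n.+2.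
Proof.
move=> hV [|n].
  (* The ratio bounds do not reach [V 1 / V 0 = 8 < 16], so this case is computed: [64 < 288]. *)
  by case: hV => V0 V1 /(_ 2%N isT); rewrite /= V0 V1 => r; lra.
have [a0 lo up] := flf_ratio_bounds _ _ hV n.
have [b0 lo' _] := flf_ratio_bounds _ _ hV n.+1.
(* The upper bound at [n] gives the first inequality, the lower bound at [n.+1] the second. *)
apply: (@lt_le_trans _ _ (16 * n.+3%:R * V n.+1 * V n.+2)).
  by rewrite expr2 mulrA ltr_pM2r.
rewrite [leLHS](_ : _ = n.+3%:R * V n.+1 * (16 * V n.+2)); last by ring.
by rewrite ler_pM2l // mulr_gt0 // ltr0Sn.
Qed.

Theorem theorem1p5 (R : realFieldType) (V : nat -> R)
    (hV : fennessey_larcombe_french V) :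
  strictly_log_convex (fun n : nat => (n`!)%:R * V n) /\
  (forall n : nat, (1 <= n)%N ->
     n%:R * V n ^+ 2 < (n.+1)%:R * V n.-1 * V n.+1).
Proof.
split=> -[//|n] _; last exact: flf_log_convex_ineq.
(* This is the common factor of both sides of the log-convexity inequality at index [n.+1]. *)
have f0 : 0 < (n`!)%:R * n.+1`!%:R :> R by rewrite mulr_gt0 ?ltr0n ?fact_gt0.
have := flf_log_convex_ineq _ _ hV n; rewrite -(ltr_pM2l f0) /=.
congr (_ < _); last by rewrite [n.+2`!]factS natrM; ring.
by rewrite [n.+1`!]factS natrM; ring.
Qed.
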